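(* Let $(c_0,c_1)$ be a coherent pair of positive definite linear functionals on real polynomials, with associated sequence $\{\sigma_n\}_{n\ge 1}$, and let $n\ge 1$. Let $A_n$ be the polynomials defined by $A_0(\lambda)=1$, $A_1(\lambda)=\lambda-\frac{k_1^{(0)}}{k_0^{(1)}}$ and, for $n\ge 2$, $$A_n(\lambda)=\Big(\lambda-\frac{k_n^{(0)}}{n^2k_{n-1}^{(1)}}-\frac{\sigma_{n-1}^2}{(n-1)^2}\frac{k_{n-1}^{(0)}}{k_{n-1}^{(1)}}\Big)A_{n-1}(\lambda)-\frac{\sigma_{n-1}^2(k_{n-1}^{(0)})^2}{(n-1)^4k_{n-1}^{(1)}k_{n-2}^{(1)}}A_{n-2}(\lambda),$$ and let $\mu_{1,n}$ be the smallest zero of $A_n$. Then $$c_1((p')^2)\le \frac{1}{\mu_{1,n}}\,c_0(p^2)\qquad\text{for all } p\in\mathcal P_n .$$ Moreover, an extremal polynomial $\tilde p$, for which this inequality becomes an equality, is given by $$\tilde p=\sum_{j=1}^n\frac{w_j^{(1,n)}}{j\sqrt{k_{j-1}^{(1)}}}\,R_j,$$ where $(w_1^{(1,n)},\dots,w_n^{(1,n)})^T$ is an eigenvector of the matrix $\tilde K_{n,1}$ for the eigenvalue $\mu_{1,n}$.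
   Context: $\mathcal P_n$ is the space of real polynomials in one variable of degree at most $n$. Let $\{P_n\}_{n\ge0}$ (resp. $\{T_n\}_{n\ge0}$) be the monic orthogonal polynomials with respect to $c_0$ (resp. $c_1$). The pair $(c_0,c_1)$ is called coherent if there are real numbers $\sigma_n\neq0$, $n\ge1$, such that $T_n(x)=\frac{P_{n+1}'(x)}{n+1}-\sigma_n\frac{P_n'(x)}{n}$ for all $n\ge1$. Put $k_n^{(0)}=c_0(P_n^2)$ and $k_n^{(1)}=c_1(T_n^2)$; these are positive. Define $R_0=1$, $R_1=P_1$, and $R_i=P_i-\sigma_{i-1}\frac{i}{i-1}P_{i-1}$ for $i\ge2$. The matrix $\tilde K_{n,1}$ is the $n\times n$ symmetric tridiagonal (positive definite) matrix, indexed by $1,\dots,n$, with entries $\tilde K_{n,1}(1,1)=\frac{k_1^{(0)}}{k_0^{(1)}}$, $\tilde K_{n,1}(i,i)=\frac{k_i^{(0)}}{i^2k_{i-1}^{(1)}}+\frac{\sigma_{i-1}^2}{(i-1)^2}\frac{k_{i-1}^{(0)}}{k_{i-1}^{(1)}}$ for $2\le i\le n$, and $\tilde K_{n,1}(i+1,i)=\tilde K_{n,1}(i,i+1)=-\frac{\sigma_ik_i^{(0)}}{i^2\sqrt{k_{i-1}^{(1)}k_i^{(1)}}}$ for $1\le i\le n-1$. Its characteristic polynomial is $A_n(\lambda)=\det(\lambda I-\tilde K_{n,1})$. *)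

(* Defs.v *)
From HB Require Import structures.
From mathcomp Require Import all_boot all_order all_algebra.
From mathcomp Require Import reals.

Set Implicit Arguments.
Unset Strict Implicit.
Unset Printing Implicit Defensive.

Import Order.TTheory GRing.Theory Num.Theory.

Local Open Scope ring_scope.

Definition positive_definite (R : realType) (c : {scalar {poly R}}) : Prop :=
  forall p : {poly R}, p != 0 -> 0 < c (p ^+ 2).

Definition monic_orthogonal (R : realType) (c : {scalar {poly R}})
    (P : nat -> {poly R}) : Prop :=
  (forall n, P n \is monic /\ size (P n) = n.+1) /\
  (forall m n, m != n -> c (P m * P n) = 0).

Definition coherent_with (R : realType) (P T : nat -> {poly R})
    (sigma : nat -> R) : Prop :=
  forall n : nat, (1 <= n)%N ->
    sigma n != 0 /\
    T n = n.+1%:R^-1 *: (P n.+1)^`() - (sigma n / n%:R) *: (P n)^`().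

Definition sqnorm (R : realType) (c : {scalar {poly R}})
    (P : nat -> {poly R}) (n : nat) : R := c (P n ^+ 2).

(* Under coherence, (Rbasis P sigma i.+1)^`() = i.+1%:R *: T i. *)
Definition Rbasis (R : realType) (P : nat -> {poly R}) (sigma : nat -> R)
    (i : nat) : {poly R} :=
  match i with
  | 0 => 1
  | 1 => P 1%N
  | (_.+1 as j).+1 => P j.+1 - (sigma j * (j.+1%:R / j%:R)) *: P j
  end.

Fixpoint Apoly (R : realType) (k0 k1 sigma : nat -> R) (n : nat) : {poly R} :=
  match n with
  | 0 => 1
  | n1.+1 =>
    match n1 with
    | 0 => 'X - (k0 1%N / k1 0%N)%:P
    | n2.+1 =>
      ('X - (k0 n / (n%:R ^+ 2 * k1 n1))%:P
          - (sigma n1 ^+ 2 / n1%:R ^+ 2 * (k0 n1 / k1 n1))%:P)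
        * Apoly k0 k1 sigma n1
      - (sigma n1 ^+ 2 * k0 n1 ^+ 2 / (n1%:R ^+ 4 * k1 n1 * k1 n2))%:P
        * Apoly k0 k1 sigma n2
    end
  end.

(* Diagonal entry (i, i) and off-diagonal entries (i, i+1), (i+1, i), for i
   counted from 1; the matrix below is indexed by 'I_n, hence the shifts. *)
Definition Kdiag (R : realType) (k0 k1 sigma : nat -> R) (i : nat) : R :=
  if i == 1%N then k0 1%N / k1 0%N
  else k0 i / (i%:R ^+ 2 * k1 i.-1)
       + sigma i.-1 ^+ 2 / i.-1%:R ^+ 2 * (k0 i.-1 / k1 i.-1).

Definition Koff (R : realType) (k0 k1 sigma : nat -> R) (i : nat) : R :=
  - (sigma i * k0 i / (i%:R ^+ 2 * Num.sqrt (k1 i.-1 * k1 i))).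

Definition Kmatrix (R : realType) (k0 k1 sigma : nat -> R) (n : nat) : 'M[R]_n :=
  \matrix_(i, j)
    if i == j :> nat then Kdiag k0 k1 sigma i.+1
    else if j == i.+1 :> nat then Koff k0 k1 sigma i.+1
    else if i == j.+1 :> nat then Koff k0 k1 sigma j.+1
    else 0.

Definition smallest_zero (R : realType) (p : {poly R}) (mu : R) : Prop :=
  root p mu /\ forall x : R, root p x -> mu <= x.

Definition eigenvector (R : realType) (n : nat) (K : 'M[R]_n) (mu : R)
    (w : 'cV[R]_n) : Prop :=
  w != 0 /\ K *m w = mu *: w.

Definition extremal_poly (R : realType) (P : nat -> {poly R})
    (k1 sigma : nat -> R) (n : nat) (w : 'cV[R]_n) : {poly R} :=
  \sum_(j < n) (w j 0 / (j.+1%:R * Num.sqrt (k1 j))) *: Rbasis P sigma j.+1.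

(* Main.v *)
Require Import Defs.
From HB Require Import structures.
From mathcomp Require Import all_boot all_order all_algebra.
From mathcomp Require Import reals.
From mathcomp Require Import complex ring zify.

Set Implicit Arguments.
Unset Strict Implicit.
Unset Printing Implicit Defensive.

Import Order.TTheory GRing.Theory Num.Theory.

Local Open Scope ring_scope.

(* Write [p = a + sum_j v_j q_j] with [q_j = R_j / (j sqrt k_{j-1}^{(1)})].
   By coherence the [q_j'] are the orthonormal polynomials of [c1], so
   [c1 (p'^2) = v^T v]; and the Gram matrix of the [q_j] for [c0] is the
   tridiagonal matrix [K], so [c0 (p^2) = a^2 c0 1 + v^T K v].  The inequality
   is thus the variational characterization of the smallest eigenvalue of [K],
   whose characteristic polynomial satisfies the three-term recurrence of [A_n]. *)

(** * Determinants of tridiagonal matrices *)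

Definition tridiag_mx (S : Type) (z : S) (a b c : nat -> S) n : 'M[S]_n :=
  \matrix_(i, j)
    if i == j :> nat then a i
    else if j == i.+1 :> nat then b i
    else if i == j.+1 :> nat then c j
    else z.

Lemma cofactor_max (S : comNzRingType) m (M : 'M[S]_m.+1) :
  cofactor M ord_max ord_max =
  \det (mxsub (widen_ord (leqnSn m)) (widen_ord (leqnSn m)) M).
Proof.
rewrite /cofactor -signr_odd oddD addbb mul1r; congr (\det _).
by apply/matrixP=> i j; rewrite !mxE; congr (M _ _); apply: val_inj;
  rewrite /= /bump leqNgt ltn_ord.
Qed.

(** Laplace expansion along the last row, which has two nonzero entries. The minor of the entry
    [c n] has [b n] as the only nonzero entry of its last column; a second expansion leaves the
    leading block of size [n]. *)
Lemma det_tridiag_mx (S : comNzRingType) (a b c : nat -> S) n :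
  \det (tridiag_mx 0 a b c n.+2) =
  a n.+1 * \det (tridiag_mx 0 a b c n.+1)
    - b n * c n * \det (tridiag_mx 0 a b c n).
Proof.
rewrite (expand_det_row _ ord_max) !big_ord_recr /= big1 ?add0r; last first.
  move=> i _; have lin := ltn_ord i; rewrite mxE /=.
  by do !case: eqP => [|_]; rewrite ?mul0r //; lia.
rewrite !mxE /= !eqxx gtn_eqF // ltn_eqF ?ltnS ?leqnSn //.
rewrite addrC cofactor_max; congr (_ * _ + _).
  by congr (\det _); apply/matrixP=> i j; rewrite !mxE.
rewrite [cofactor _ _ _]/cofactor.
rewrite (expand_det_col _ ord_max) big_ord_recr big1 ?Monoid.mul1m; last first.
  move=> i _; have lin := ltn_ord i; rewrite !mxE /= /bump.
  by do !case: eqP => [|_]; rewrite ?mul0r //; lia.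
rewrite cofactor_max -signr_odd addSn oddS oddD addbb expr1 mulN1r mulrN.
congr (- _); rewrite [b n * _]mulrC -mulrA. congr (_ * (_ * _)).
  rewrite !mxE /= /bump leqnn ltnn eqxx ltn_eqF // add1n ltnS leqnn.
congr (\det _); apply/matrixP=> i j; have := ltn_ord i; have := ltn_ord j.
rewrite !mxE /= /bump => lti ltj.
by rewrite [(n < i)%N]ltnNge (leqNgt n j) (ltnW ltj) lti.
Qed.

(** * The smallest eigenvalue of a real symmetric matrix *)

(* Over [R[i]] the matrix is Hermitian, so the spectral theorem for normal
   matrices applies. *)
Lemma symmetric_min_eigenvalue (R : rcfType) n (K : 'M[R]_n.+1) : K^T = K ->
  exists2 mu, root (char_poly K) mu &
    forall v : 'cV_n.+1, mu * (v^T *m v) 0 0 <= (v^T *m K *m v) 0 0.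
Proof.
move=> symK; pose f : {rmorphism R -> R[i]} := real_complex R.
pose KC := map_mx f K.
have f_real x : f x \is Num.real by rewrite complex_real.
have KC_sym : KC \is symmetricmx.
  apply/is_hermitianmxP/matrixP=> i j.
  by rewrite expr0 scale1r !mxE -[in LHS]symK mxE.
have KC_real : KC \is a realmx by apply/mxOverP=> i j; rewrite mxE f_real.
have KC_herm := realsym_hermsym KC_sym KC_real.
have /mxOverP d_real := hermitian_spectral_diag_real KC_herm.
have /orthomx_spectralP := hermitian_normalmx KC_herm.
have := spectral_unitarymx KC; have := spectral_unit KC.
move: (spectralmx KC) (spectral_diag KC) d_real => Q d d_real Q_unit Q_unitary.
pose r i : R := complex.Re (d 0 i).
have dE i : d 0 i = f (r i) by rewrite -[LHS]RRe_real ?d_real.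
move=> KCE; case: (@arg_minP _ _ _ ord0 xpredT r isT) => i0 _ r_min.
exists (r i0).
  rewrite -(fmorph_root f) map_char_poly -/KC -eigenvalue_root_char -dE.
  (* Row [i0] of the diagonalizing matrix [Q] is a left eigenvector; it is nonzero because [Q] is
     invertible. *)
  apply/eigenvalueP; exists (row i0 Q).
    by rewrite KCE -row_mul !mulmxA mulmxV // mul1mx row_mul row_diag_mx
               -scalemxAl -rowE.
  apply: contraTneq Q_unit => Q0; rewrite -row_free_unit.
  apply/negP=> /row_freeP[B /(congr1 (row i0))].
  rewrite row_mul Q0 mul0mx => /rowP/(_ i0); rewrite !mxE eqxx => /esym/eqP.
  by rewrite oner_eq0.
move=> v; pose u := Q *m map_mx f v.
have vT : (map_mx f v)^T = ((map_mx f v)^t*)%sesqui.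
  by apply/matrixP=> i j; rewrite !mxE (CrealP (f_real _)).
(* The diagonal [e] is kept arbitrary: [d] yields the quadratic form of [KC], and the constant 1
   yields the squared norm of [v]. *)
have quad e : ((map_mx f v)^T *m (invmx Q *m diag_mx e *m Q) *m map_mx f v) 0 0
    = \sum_i e 0 i * `|u i 0| ^+ 2.
  rewrite invmx_unitary // vT !mulmxA -map_mxM -trmx_mul -/u -mulmxA.
  rewrite -mulmxA -/u mxE; apply: eq_bigr => i _.
  rewrite mul_diag_mx !mxE. rewrite mulrCA normCK.
  by congr (_ * _); exact: mulrC.
have quadK : f ((v^T *m K *m v) 0 0) = \sum_i f (r i) * `|u i 0| ^+ 2.
  have -> : f ((v^T *m K *m v) 0 0) = (map_mx f (v^T *m K *m v)) 0 0.
    by rewrite [RHS]mxE.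
  rewrite !map_mxM -map_trmx -/KC KCE quad.
  by apply: eq_bigr => i _; rewrite dE.
have quad1 : f ((v^T *m v) 0 0) = \sum_i `|u i 0| ^+ 2.
  have -> : f ((v^T *m v) 0 0) = (map_mx f (v^T *m v)) 0 0 by rewrite [RHS]mxE.
  have := quad (const_mx 1); rewrite diag_const_mx mulmx1 mulVmx // mulmx1.
  rewrite map_mxM -map_trmx => ->.
  by apply: eq_bigr => i _; rewrite mxE mul1r.
rewrite -lecR (rmorphM f) quadK quad1 mulr_sumr; apply: ler_sum => i _.
by rewrite ler_wpM2r ?exprn_ge0 // lecR r_min.
Qed.

Lemma char_poly_Kmatrix (R : realType) (k0 k1 sigma : nat -> R) n :
    (forall i, 0 < k1 i) ->
  char_poly (Kmatrix k0 k1 sigma n) = Apoly k0 k1 sigma n.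
Proof.
move=> k1_gt0.
pose a i : {poly R} := 'X - (Kdiag k0 k1 sigma i.+1)%:P.
pose b i : {poly R} := - (Koff k0 k1 sigma i.+1)%:P.
have char_tridiag m : char_poly (Kmatrix k0 k1 sigma m)
    = \det (tridiag_mx 0 a b b m).
  congr (\det _); apply/matrixP=> i j; rewrite !mxE -val_eqE.
  by do !case: ifP => _; rewrite ?mulr1n ?mulr0n ?sub0r // oppr0.
rewrite char_tridiag; elim/ltn_ind: n => -[|[|n]] IHn.
- by rewrite det_mx00.
- by rewrite det_mx11 mxE.
rewrite det_tridiag_mx !IHn //=; congr (_ * _ - _ * _).
  by rewrite /a /Kdiag /= polyCD opprD addrA.
(* The off-diagonal entry enters only through its square, which removes its sign and its square
   root. *)
rewrite /b mulrNN -polyCM; congr (_%:P).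
rewrite /Koff mulrNN -expr2 expr_div_n !exprMn sqr_sqrtr; last first.
  by rewrite mulr_ge0 ?ltW.
by congr (_ / _); rewrite /=; ring.
Qed.

(* Division by [0] gives [0], which makes the case [i = 0] uniform here and in
   [Rbasis_succ]. *)
Lemma Kdiag_succ (R : realType) (k0 k1 sigma : nat -> R) i :
  Kdiag k0 k1 sigma i.+1 =
  k0 i.+1 / (i.+1%:R ^+ 2 * k1 i) + (sigma i * i%:R^-1) ^+ 2 * (k0 i / k1 i).
Proof.
rewrite /Kdiag exprMn exprVn; case: i => //=.
by rewrite expr1n mul1r expr0n invr0 mulr0 mul0r addr0.
Qed.

(** Since [Q n] is monic of degree n, subtracting a suitable multiple of it cancels the coefficient
    of degree n. *)
Lemma monic_sequence_span (S : nzRingType) (Q : nat -> {poly S}) n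
    (p : {poly S}) :
    (forall i, Q i \is monic /\ size (Q i) = i.+1) -> (size p <= n)%N ->
  exists a : nat -> S, p = \sum_(i < n) a i *: Q i.
Proof.
move=> Q_monic; elim: n p => [|n IHn] p size_p.
  by exists (fun=> 0); rewrite big_ord0; apply/eqP; rewrite -size_poly_leq0.
have [/monicP Qn_lead Qn_size] := Q_monic n.
have /IHn[a pE] : (size (p - p`_n *: Q n)%R <= n)%N.
  apply/leq_sizeP=> j; rewrite leq_eqVlt coefB coefZ => /predU1P[<-|ltnj].
    by move: Qn_lead; rewrite /lead_coef Qn_size => ->; rewrite mulr1 subrr.
  rewrite (nth_default _ (leq_trans size_p ltnj)).
  rewrite [(Q n)`_j]nth_default ?Qn_size //.
  by rewrite mulr0 subr0.
exists (fun i => if (i < n)%N then a i else p`_n).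
rewrite big_ord_recr /= ltnn; apply/eqP; rewrite -subr_eq pE; apply/eqP.
by apply: eq_bigr => i _; rewrite ltn_ord.
Qed.

Lemma scalar_sum_sqr (R : comNzRingType) (A : comAlgType R) (c : {scalar A}) n
    (q : 'I_n -> A) (v : 'cV[R]_n) :
  c ((\sum_i v i 0 *: q i) ^+ 2) =
  (v^T *m (\matrix_(i, j) c (q i * q j)) *m v) 0 0.
Proof.
rewrite expr2 mulr_sumr linear_sum mxE; apply: eq_bigr => j _ /=.
rewrite mulr_suml linear_sum mxE mulr_suml; apply: eq_bigr => i _ /=.
by rewrite !mxE -scalerAl -scalerAr !linearZ /=; ring.
Qed.

Lemma cV_sqr_gt0 (S : realDomainType) n (w : 'cV[S]_n) :
  w != 0 -> 0 < (w^T *m w) 0 0.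
Proof.
move=> /cV0Pn[i wi_neq0]; rewrite mxE (bigD1 i) //= mxE -expr2.
rewrite ltr_wpDr ?exprn_even_gt0 // sumr_ge0 // => j _.
by rewrite mxE -expr2 sqr_ge0.
Qed.

Lemma sqnorm_gt0 (R : realType) (c : {scalar {poly R}}) Q n :
  positive_definite c -> monic_orthogonal c Q -> 0 < sqnorm c Q n.
Proof.
move=> c_pos [Q_monic _]; apply: c_pos; rewrite -size_poly_eq0.
by have [_ ->] := Q_monic n.
Qed.

Lemma orthogonal_delta (R : realType) (c : {scalar {poly R}}) Q i j :
  monic_orthogonal c Q -> c (Q i * Q j) = if i == j then sqnorm c Q i else 0.
Proof. by move=> [_ Q_orth]; case: eqP => [->|/eqP/Q_orth]. Qed.

(** * The basis [R_j] of a coherent pair and its Gram matrices *)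

Section Coherent.

Variables (R : realType) (c0 c1 : {scalar {poly R}}).
Variables (P T : nat -> {poly R}) (sigma : nat -> R).
Hypothesis c1_pos : positive_definite c1.
Hypothesis P_orth : monic_orthogonal c0 P.
Hypothesis T_orth : monic_orthogonal c1 T.
Hypothesis coh : coherent_with P T sigma.

Local Notation k0 := (sqnorm c0 P).
Local Notation k1 := (sqnorm c1 T).
Local Notation Rb := (Rbasis P sigma).

Lemma Rbasis_succ i :
  Rb i.+1 = P i.+1 - (sigma i * (i.+1%:R / i%:R)) *: P i.
Proof. by case: i => //; rewrite invr0 !mulr0 scale0r subr0. Qed.

Lemma Rbasis_monic i : Rb i \is monic /\ size (Rb i) = i.+1.
Proof.
case: P_orth => P_monic _; case: i => [|i]; first by rewrite monic1 size_poly1.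
have [P_lead P_size] := P_monic i.+1.
have lt_size :
    (size (- ((sigma i * (i.+1%:R / i%:R)) *: P i))%R < size (P i.+1))%N.
  rewrite size_polyN P_size ltnS (leq_trans (size_scale_leq _ _)) //.
  by have [_ ->] := P_monic i.
by rewrite Rbasis_succ size_polyDl // monicE lead_coefDl.
Qed.

(** The ratio (i+1)/i in the definition of [R_{i+1}] is what the coherence relation acquires when
    multiplied by i+1. *)
Lemma deriv_Rbasis i : (Rb i.+1)^`() = i.+1%:R *: T i.
Proof.
have [P_monic _] := P_orth; have [T_monic _] := T_orth.
(* Coherence starts at index 1. For i = 0 both sides are the constant 1, because [P 1] and [T 0] are
   monic. *)
case: i => [|i].
  rewrite scale1r; have [/monicP T_lead T_size] := T_monic 0.
  have [/monicP P_lead P_size] := P_monic 1%N.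
  move: P_lead T_lead; rewrite !lead_coefE P_size T_size /= => P1 T0.
  apply/polyP=> -[|j]; first by rewrite coef_deriv P1 T0.
  by rewrite coef_deriv !nth_default ?mul0rn ?P_size ?T_size.
have [_ ->] := coh (ltn0Sn i).
have n0 m : m.+1%:R != 0 :> R by rewrite pnatr_eq0.
rewrite Rbasis_succ derivB derivZ scalerBr !scalerA mulfV // scale1r.
by congr (_ - _ *: _); field; rewrite nat1r.
Qed.

(* The derivatives of the [normR j] are the orthonormal polynomials of [c1]. *)
Definition normR (j : nat) : {poly R} :=
  (j.+1%:R * Num.sqrt (k1 j))^-1 *: Rb j.+1.

Lemma extremal_polyE n (w : 'cV[R]_n) :
  extremal_poly P k1 sigma w = \sum_(j < n) w j 0 *: normR j.
Proof. by apply: eq_bigr => j _; rewrite /normR scalerA. Qed.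

Lemma normR_gram_deriv i j : c1 ((normR i)^`() * (normR j)^`()) = (i == j)%:R.
Proof.
have k1_gt0 m := sqnorm_gt0 m c1_pos T_orth.
rewrite /normR !derivZ !deriv_Rbasis -!scalerAl -!scalerAr !linearZ /=.
rewrite (orthogonal_delta _ _ T_orth); case: eqP => [<-|_];
  last by rewrite !mulr0.
have s0 : Num.sqrt (k1 i) != 0 by rewrite sqrtr_eq0 -ltNge.
have := sqr_sqrtr (ltW (k1_gt0 i)).
by move: (Num.sqrt _ : R) s0 => s s0 <- /=; field; rewrite s0 nat1r pnatr_eq0.
Qed.

(** Each [R_{i+1}] involves only [P_{i+1}] and [P_i], so orthogonality kills all products except
    those of equal or neighbouring indices. *)
Lemma normR_gram n :
  \matrix_(i < n, j < n) c0 (normR i * normR j) = Kmatrix k0 k1 sigma n.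
Proof.
have k1_gt0 m := sqnorm_gt0 m c1_pos T_orth.
have s0 m : Num.sqrt (k1 m) != 0 by rewrite sqrtr_eq0 -ltNge.
have sk m : Num.sqrt (k1 m) ^+ 2 = k1 m by rewrite sqr_sqrtr ?ltW.
have sM l m : Num.sqrt (k1 l * k1 m) = Num.sqrt (k1 l) * Num.sqrt (k1 m).
  by rewrite sqrtrM ?ltW.
have n0 m : m.+1%:R != 0 :> R by rewrite pnatr_eq0.
have RbE i j : c0 (Rb i.+1 * Rb j.+1) =
    (if i == j then k0 i.+1 else 0)
    - (sigma j * (j.+1%:R / j%:R)) * (if i.+1 == j then k0 i.+1 else 0)
    - (sigma i * (i.+1%:R / i%:R)) * (if i == j.+1 then k0 i else 0)
    + (sigma i * (i.+1%:R / i%:R)) * (sigma j * (j.+1%:R / j%:R))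
      * (if i == j then k0 i else 0).
  rewrite !Rbasis_succ mulrBl !mulrBr -!scalerAl -!scalerAr !linearB !linearZ /=.
  by rewrite !(orthogonal_delta _ _ P_orth) eqSS; ring.
apply/matrixP=> i j; rewrite !mxE /normR -scalerAl -scalerAr !linearZ /= RbE.
case: (ltngtP i j) => [ltij|ltji|<-].
- have ltij1 : (i < j.+1)%N by rewrite ltnS ltnW.
  rewrite (ltn_eqF ltij1) [j == i.+1 :> nat]eq_sym.
  case: eqP => [<-|_]; last by ring.
  rewrite /Koff /= sM !mulr0 ?subr0 addr0 sub0r; field.
  by rewrite !s0 nat1r -natrD !pnatr_eq0.
- have ltji1 : (j < i.+1)%N by rewrite ltnS ltnW.
  rewrite (ltn_eqF ltji1) (gtn_eqF ltji1).
  case: eqP => [->|_]; last by ring.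
  rewrite /Koff /= sM !mulr0 ?subr0 addr0 sub0r; field.
  by rewrite !s0 nat1r -natrD !pnatr_eq0.
- rewrite Kdiag_succ gtn_eqF // ltn_eqF // -[X in _ / (_ * X)]sk.
  rewrite -[X in k0 i / X]sk.
  (* The identity holds for any value [x] in place of the inverse of i, so i = 0 needs no separate
     case. *)
  move: (i%:R^-1 : R) (Num.sqrt (k1 i)) (s0 i) => x s s_neq0.
  by field; rewrite s_neq0 nat1r n0.
Qed.

(** Parseval's identity. As [w] is arbitrary, [extremal_poly] serves here as the general element of
    the span of the [normR j]. *)
Lemma extremal_sqr_deriv n (w : 'cV[R]_n) :
  c1 ((extremal_poly P k1 sigma w)^`() ^+ 2) = (w^T *m w) 0 0.
Proof.
rewrite extremal_polyE raddf_sum /=.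
under eq_bigr do rewrite derivZ.
rewrite (scalar_sum_sqr c1 (fun i => (normR i)^`())).
rewrite (_ : \matrix_(_, _) _ = 1%:M) ?mulmx1 //.
by apply/matrixP=> i j; rewrite !mxE normR_gram_deriv.
Qed.

Lemma extremal_sqr n (w : 'cV[R]_n) :
  c0 (extremal_poly P k1 sigma w ^+ 2)
    = (w^T *m Kmatrix k0 k1 sigma n *m w) 0 0.
Proof. by rewrite extremal_polyE scalar_sum_sqr normR_gram. Qed.

Lemma size_extremal n (w : 'cV[R]_n) :
  (size (extremal_poly P k1 sigma w) <= n.+1)%N.
Proof.
apply: (leq_trans (size_sum _ _ _)); apply/bigmax_leqP=> i _.
apply: (leq_trans (size_scale_leq _ _)).
by have [_ ->] := Rbasis_monic i.+1; rewrite !ltnS.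
Qed.

(** The squared norm of [w] is recovered from the derivative, whence linear independence. *)
Lemma extremal_eq0 n (w : 'cV[R]_n) :
  extremal_poly P k1 sigma w = 0 -> w = 0.
Proof.
move=> pt0; apply/eqP; apply: contraTT isT => /cV_sqr_gt0.
by rewrite -extremal_sqr_deriv pt0 deriv0 expr0n linear0 ltxx.
Qed.

Lemma size_leq_extremal n (p : {poly R}) : (size p <= n.+1)%N ->
  exists a (w : 'cV[R]_n), p = a%:P + extremal_poly P k1 sigma w.
Proof.
move=> /(monic_sequence_span Rbasis_monic)[a ->].
(* The coefficient of [R_0 = 1] is the constant; the others are multiplied by the normalizing
   factors of the [normR j]. *)
exists (a 0); exists (\col_j (a j.+1 * (j.+1%:R * Num.sqrt (k1 j)))).
rewrite big_ord_recl alg_polyC; congr (_ + _); apply: eq_bigr => j _.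
by rewrite mxE mulfK // mulf_neq0 ?pnatr_eq0 // gt_eqF // sqrtr_gt0 sqnorm_gt0.
Qed.

(** Pythagoras: every [R_{j+1}] is a combination of [P_m] with m positive, hence [c0]-orthogonal to
    [P_0 = 1]. *)
Lemma sqr_const_add_extremal n a (w : 'cV[R]_n) :
  c0 ((a%:P + extremal_poly P k1 sigma w) ^+ 2) =
  a ^+ 2 * c0 1 + c0 (extremal_poly P k1 sigma w ^+ 2).
Proof.
have [P_monic P_orth0] := P_orth.
have P0 : P 0 = 1.
  have [/monicP P_lead P_size] := P_monic 0.
  move: P_lead; rewrite lead_coefE P_size /= => P00.
  by rewrite [LHS]size1_polyC ?P_size // P00.
have Rb0 j : c0 (Rb j.+1) = 0.
  have P_eq0 m : c0 (P m.+1) = 0 by rewrite -[P m.+1]mulr1 -P0 P_orth0.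
  case: j => [|j]; first exact: P_eq0.
  by rewrite Rbasis_succ linearB linearZ /= !P_eq0 mulr0 subr0.
have w0 : c0 (extremal_poly P k1 sigma w) = 0.
  by rewrite linear_sum big1 // => j _; rewrite linearZ /= Rb0 mulr0.
rewrite sqrrD !linearD /= mul_polyC linearZ /= w0 mulr0 !addr0.
by rewrite -polyC_exp -alg_polyC linearZ.
Qed.

End Coherent.

Theorem theorem1p4 (R : realType) (c0 c1 : {scalar {poly R}})
    (P T : nat -> {poly R}) (sigma : nat -> R) (n : nat)
    (c0_pos : positive_definite c0) (c1_pos : positive_definite c1)
    (P_orth : monic_orthogonal c0 P) (T_orth : monic_orthogonal c1 T)
    (coh : coherent_with P T sigma) (n_ge1 : (1 <= n)%N) :
  let k0 := sqnorm c0 P in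
  let k1 := sqnorm c1 T in
  let A := Apoly k0 k1 sigma n in
  let K := Kmatrix k0 k1 sigma n in
  (exists mu : R, smallest_zero A mu) /\
  forall mu : R, smallest_zero A mu ->
    (forall p : {poly R}, (size p <= n.+1)%N ->
       c1 (p^`() ^+ 2) <= 1 / mu * c0 (p ^+ 2)) /\
    (exists w : 'cV[R]_n, eigenvector K mu w) /\
    (forall w : 'cV[R]_n, eigenvector K mu w ->
       let pt := extremal_poly P k1 sigma w in
       [/\ pt != 0, (size pt <= n.+1)%N
         & c1 (pt^`() ^+ 2) = 1 / mu * c0 (pt ^+ 2)]).
Proof.
case: n n_ge1 => // n _ k0 k1 A K.
have k1_gt0 i : 0 < k1 i by exact: sqnorm_gt0.
have charK : char_poly K = A by exact: char_poly_Kmatrix.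
have symK : K^T = K.
  by rewrite /K -normR_gram //; apply/matrixP=> i j; rewrite !mxE mulrC.
(* [eigenvalueP] provides row eigenvectors; symmetry of [K] lets transposition turn them into
   columns and back. *)
have eigenE x : root A x <-> exists w, eigenvector K x w.
  rewrite -charK -eigenvalue_root_char; split=> [/eigenvalueP[v vK v_neq0]|].
    exists v^T; split; last by rewrite -[K]symK -trmx_mul vK linearZ.
    by apply: contraNneq v_neq0 => vT0; rewrite -[v]trmxK vT0 trmx0.
  case=> w [w_neq0 Kw]; apply/eigenvalueP; exists w^T.
    by rewrite -[K]symK -trmx_mul Kw linearZ.
  by apply: contraNneq w_neq0 => wT0; rewrite -[w]trmxK wT0 trmx0.
have quad_eigen x w : eigenvector K x w ->
    (w^T *m K *m w) 0 0 = x * (w^T *m w) 0 0.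
  by case=> _ Kw; rewrite -mulmxA Kw -scalemxAr mxE.
have [mu0 mu0_root mu0_min] := symmetric_min_eigenvalue symK.
rewrite charK in mu0_root.
have mu0_smallest : smallest_zero A mu0.
  split=> // x /eigenE[w w_eigen]; have [w_neq0 _] := w_eigen.
  have := mu0_min w; rewrite (quad_eigen _ _ w_eigen).
  by rewrite ler_pM2r ?cV_sqr_gt0.
split=> [|mu [mu_root mu_min]]; first by exists mu0.
have muE : mu = mu0.
  by apply/le_anti/andP; split; [exact: mu_min | exact: (proj2 mu0_smallest)].
rewrite -{}muE {mu0 mu0_root mu0_smallest} in mu0_min.
pose pt (w : 'cV[R]_n.+1) := extremal_poly P k1 sigma w.
have sqr0 w : c0 (pt w ^+ 2) = (w^T *m K *m w) 0 0.
  exact: (extremal_sqr sigma c1_pos P_orth T_orth).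
have sqr1 w : c1 ((pt w)^`() ^+ 2) = (w^T *m w) 0 0.
  exact: (extremal_sqr_deriv c1_pos P_orth T_orth coh).
have sqrD a w :
    c0 ((a%:P + pt w) ^+ 2) = a ^+ 2 * c0 1 + c0 (pt w ^+ 2).
  exact: (sqr_const_add_extremal c1 T sigma P_orth).
have pt_neq0 w : eigenvector K mu w -> pt w != 0.
  case=> w_neq0 _; apply: contraNneq w_neq0.
  by move/(extremal_eq0 c1_pos P_orth T_orth coh) => ->.
(* For an eigenvector [w], [mu] times its squared norm is [c0 (pt w ^+ 2)], which is positive. *)
have mu_gt0 : 0 < mu.
  have /eigenE[w w_eigen] := mu_root; have [w_neq0 _] := w_eigen.
  rewrite -(pmulr_lgt0 _ (cV_sqr_gt0 w_neq0)) -(quad_eigen _ _ w_eigen) -sqr0.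
  by rewrite c0_pos ?pt_neq0.
split=> [p /(size_leq_extremal sigma c1_pos P_orth T_orth)[a [w ->]]|].
  rewrite derivD derivC add0r -/k1 -/(pt w) sqr1.
  rewrite sqrD sqr0 div1r mulrC ler_pdivlMr // mulrC.
  (* The constant term of p leaves the derivative unchanged and only adds the nonnegative
     [a ^+ 2 * c0 1] on the right. *)
  apply: le_trans (mu0_min w) _; rewrite lerDr mulr_ge0 ?sqr_ge0 //.
  by rewrite -(expr1n _ 2) ltW ?c0_pos ?oner_neq0.
split=> [|w w_eigen]; first exact/eigenE.
split; [exact: pt_neq0 | exact: (size_extremal c1 T sigma P_orth) |].
by rewrite -/(pt w) sqr0 sqr1 (quad_eigen _ _ w_eigen) div1r mulKf // gt_eqF.
Qed.
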